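(* Let $n\in\mathbb{Z}_+$ and $K=2n+1$. For each $L$, let $\theta^*_{(L,K)}$ be a minimizer of $\mathbb{E}_{(\mathbf{M},\mathbf{y})\sim\tau}\|\mathbf{y}-\bar f_{\tilde\theta}(\mathbf{M})\|^2$ over $\tilde\theta\in\tilde\Theta_{L,K}$. Then the optimal truncated general operator recurrent networks $\bar f_{\theta^*_{(L,K)}}$ of depth $L$ and level $K$ satisfy $$\lim_{L\to\infty}\bar f_{\theta^*_{(L,K)}}(\mathbf{M})=\mathbb{E}(\mathbf{y}\,|\,\mathbf{M})\quad\text{in }L^2(\Omega;\Sigma,d\mathbb{P})^n.$$
   Context: $(\Omega,\Sigma,\mathbb{P})$ is a complete probability space. $\mathcal{B}^{n\times n}(\rho)$ denotes the closed ball of radius $\rho$ in $\mathbb{R}^{n\times n}$ in operator norm. $f:\mathcal{B}^{n\times n}(1)\to\mathbb{R}^n$ is bounded and continuous, $\|f\|_\infty=\sup_{X\in\mathcal{B}^{n\times n}(1)}\|f(X)\|$. $\mathbf{z}$ is a random vector, $\mathbf{X}=F(\mathbf{z})$ is a random matrix (with $F$ a given map into $\mathbb{R}^{n\times n}$) with $\mathbf{X}\in\mathcal{B}^{n\times n}(\frac12)$ a.s., $\mathbf{y}=f(\mathbf{X})$, $\mathcal{E}$ is a random matrix independent of $\mathbf{X}$ with $\mathcal{E}\in\mathcal{B}^{n\times n}(\frac12)$ a.s., and $\mathbf{M}=\mathbf{X}+\mathcal{E}$; $\tau$ is the distribution of $(\mathbf{M},\mathbf{y})$. $\mathbb{E}(\mathbf{y}|\mathbf{M})$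 is the conditional expectation of $\mathbf{y}$ with respect to the $\sigma$-algebra generated by $\mathbf{M}$. A general operator recurrent network of depth $L$, level $K$, width $n$ is $f_{\tilde\theta}(X)=h_L$ with $h_j=0$ for $j\le0$ and, for $1\le\ell\le L$, $$h_\ell=b^{\ell,0}+\sum_{k=1}^K(A^{\ell,k,0}h_{\ell-k}+B^{\ell,k,0}Xh_{\ell-k})+\phi\Big[b^{\ell,1}+\sum_{k=1}^K(A^{\ell,k,1}h_{\ell-k}+B^{\ell,k,1}Xh_{\ell-k})\Big],$$ with $\phi$ the componentwise ReLU $y\mapsto\max(y,0)$. The biases and weights are given by parameters $\tilde\theta$ consisting of vectors $\tilde\theta_p^{\ell,i,k}\in\mathbb{R}^n$ ($1\le\ell\le L$, $i\in\{0,1\}$, $1\le k\le K$, $1\le p\le4n$) and $\tilde\theta_0^{\ell,i,0}\in\mathbb{R}^n$ through $b^{\ell,i}=\tilde\theta_0^{\ell,i,0}$, $A^{\ell,k,i}=\sum_{p=1}^n\tilde\theta_{2p-1}^{\ell,i,k}(\tilde\theta_{2p}^{\ell,i,k})^T$, $B^{\ell,k,i}=\sum_{p=n+1}^{2n}\tilde\theta_{2p-1}^{\ell,i,k}(\tilde\theta_{2p}^{\ell,i,k})^T$ (vanishing non-learned parts). $\tilde\Theta_{L,K}$ is the set of all such $\tilde\theta$ with every component vector of Euclidean norm at most $1$. The truncated network is $\bar f_{\tilde\theta}=T\circ f_{\tilde\theta}$, where $T$ acts componentwise by $x_j\mapsto\max(-\|f\|_\infty,\min(x_j,\|f\|_\infty))$.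 *)

(* Defs.v *)
From HB Require Import structures.
From mathcomp Require Import all_boot all_order all_algebra.
From mathcomp Require Import all_classical all_reals all_analysis.

Set Implicit Arguments.
Unset Strict Implicit.
Unset Printing Implicit Defensive.

Import Order.TTheory GRing.Theory Num.Theory.
Import numFieldNormedType.Exports.

Local Open Scope classical_set_scope.
Local Open Scope ring_scope.

(* Euclidean and operator norms. The norm `|A| that the library puts on
   'M[R]_(m, n) is the maximum of the absolute values of the entries; it is used
   below only through the topology it induces. *)
Definition norm2 (R : realType) (n : nat) (v : 'cV[R]_n) : R :=
  Num.sqrt (\sum_(i < n) v i 0 ^+ 2).

Definition opnorm (R : realType) (n : nat) (A : 'M[R]_n) : R :=
  sup [set norm2 (A *m v) | v in [set v : 'cV[R]_n | norm2 v <= 1]].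

Definition opball (R : realType) (n : nat) (rho : R) : set 'M[R]_n :=
  [set A | opnorm A <= rho].

(* A map on the unit ball opball 1 is represented by a total function whose
   values outside opball 1 are irrelevant. *)
Definition supnorm (R : realType) (n : nat) (f : 'M[R]_n -> 'cV[R]_n) : R :=
  sup [set norm2 (f X) | X in opball 1].

Notation borelType T := (g_sigma_algebraType (@open T)).

Definition independent_RVs d (T : measurableType d) (R : realType)
    (P : probability T R) d1 (T1 : measurableType d1)
    d2 (T2 : measurableType d2) (X : T -> T1) (Y : T -> T2) : Prop :=
  forall (A : set T1) (B : set T2), measurable A -> measurable B ->
    P (X @^-1` A `&` Y @^-1` B) = (P (X @^-1` A) * P (Y @^-1` B))%E.

(* g is a version of the conditional expectation E(y | M) *)
Definition is_cond_exp d (T : measurableType d) (R : realType)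
    (P : probability T R) d' (U : measurableType d') (n : nat)
    (M : T -> U) (y g : T -> 'cV[R]_n) : Prop :=
  forall i : 'I_n,
  [/\ measurable_fun [set: g_sigma_algebra_preimageType M]
        (fun w : g_sigma_algebra_preimageType M => g w i 0),
      P.-integrable [set: T] (fun w => (g w i 0)%:E) &
      forall A : set T, g_sigma_algebra_preimage M A ->
        (\int[P]_(w in A) (g w i 0)%:E = \int[P]_(w in A) (y w i 0)%:E)%E].

Definition in_L2 d (T : measurableType d) (R : realType)
    (P : probability T R) (n : nat) (u : T -> 'cV[R]_n) : Prop :=
  forall i : 'I_n, (fun w => u w i 0) \in Lfun P 2%:E.

Definition cvg_L2 d (T : measurableType d) (R : realType)
    (P : probability T R) (n : nat)
    (u : nat -> T -> 'cV[R]_n) (g : T -> 'cV[R]_n) : Prop :=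
  [/\ forall k, in_L2 P (u k),
      in_L2 P g &
      Lnorm P 2%:E (fun w => (norm2 (u k w - g w))%:E) @[k --> \oo] --> 0%E].

(* Indices are shifted to start at 0: layer l : 'I_L, level k : 'I_K and
   component p : 'I_(4 * n) stand for l + 1, k + 1 and p + 1. *)
Record net_param (R : realType) (n L K : nat) := NetParam {
  theta_bias : 'I_L -> 'I_2 -> 'cV[R]_n ;
  theta_weight : 'I_L -> 'I_2 -> 'I_K -> 'I_(4 * n) -> 'cV[R]_n
}.

Definition param_set (R : realType) (n L K : nat) : set (net_param R n L K) :=
  [set t | (forall l i, norm2 (theta_bias t l i) <= 1) /\
           (forall l i k p, norm2 (theta_weight t l i k p) <= 1)].

Fact fst_index_lt (n : nat) (p : 'I_(2 * n)) : (2 * p < 4 * n)%N.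
Proof. by rewrite -[4%N]/(2 * 2)%N -mulnA ltn_mul2l /=. Qed.

Fact snd_index_lt (n : nat) (p : 'I_(2 * n)) : (2 * p + 1 < 4 * n)%N.
Proof.
case: p => p /= ltp.
by rewrite -[4%N]/(2 * 2)%N -mulnA addn1 [(2 * p)%N]mul2n (mul2n (2 * n)) ltn_Sdouble.
Qed.

Section network.
Variables (R : realType) (n L K : nat) (t : net_param R n L K).

(* For q = p + 1 this is theta_(2q-1) *m (theta_(2q))^T. *)
Definition outer (l : 'I_L) (k : 'I_K) (i : 'I_2) (p : 'I_(2 * n)) : 'M[R]_n :=
  theta_weight t l i k (Ordinal (fst_index_lt p)) *m
  (theta_weight t l i k (Ordinal (snd_index_lt p)))^T.

Definition weightA (l : 'I_L) (k : 'I_K) (i : 'I_2) : 'M[R]_n :=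
  \sum_(p < 2 * n | (p < n)%N) outer l k i p.

Definition weightB (l : 'I_L) (k : 'I_K) (i : 'I_2) : 'M[R]_n :=
  \sum_(p < 2 * n | (n <= p)%N) outer l k i p.

Definition relu (v : 'cV[R]_n) : 'cV[R]_n :=
  map_mx (fun x => Num.max x 0) v.

(* hs = [:: h_l; h_(l-1); ...; h_1] lists the outputs of the previous layers,
   latest first; nth 0 hs k is h_((l+1)-(k+1)), and is 0 when that index is
   not positive. *)
Definition affine (X : 'M[R]_n) (hs : seq 'cV[R]_n) (l : 'I_L) (i : 'I_2) :
    'cV[R]_n :=
  theta_bias t l i + \sum_(k < K) (weightA l k i *m nth 0 hs k +
                                   weightB l k i *m X *m nth 0 hs k).

Definition layer (X : 'M[R]_n) (hs : seq 'cV[R]_n) (l : 'I_L) : 'cV[R]_n :=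
  affine X hs l 0 + relu (affine X hs l 1).

Definition net (X : 'M[R]_n) : 'cV[R]_n :=
  head 0 (foldl (fun hs l => layer X hs l :: hs) [::] (enum 'I_L)).

(* f is the target map; only its sup norm is used, as the truncation level. *)
Definition trunc_net (f : 'M[R]_n -> 'cV[R]_n) (X : 'M[R]_n) : 'cV[R]_n :=
  map_mx (fun x => Num.max (- supnorm f) (Num.min x (supnorm f))) (net X).

End network.

(* expected loss when (M, y) has distribution tau *)
Definition risk (R : realType) (n L K : nat)
    (tau : set (borelType 'M[R]_n * borelType 'cV[R]_n) -> \bar R)
    (f : 'M[R]_n -> 'cV[R]_n) (t : net_param R n L K) : \bar R :=
  (\int[tau]_p ((norm2 ((p.2 : 'cV[R]_n) - trunc_net t f p.1)) ^+ 2)%:E)%E.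

Definition is_minimizer (R : realType) (n L K : nat)
    (tau : set (borelType 'M[R]_n * borelType 'cV[R]_n) -> \bar R)
    (f : 'M[R]_n -> 'cV[R]_n) (t : net_param R n L K) : Prop :=
  param_set t /\
  forall t' : net_param R n L K, param_set t' -> (risk tau f t <= risk tau f t')%E.

(* Main.v *)
Require Import Defs.
From HB Require Import structures.
From mathcomp Require Import all_boot all_order all_algebra.
From mathcomp Require Import all_classical all_reals all_analysis.
From mathcomp Require Import measurable_realfun ring lra.
Import Order.TTheory GRing.Theory Num.Theory.
Import numFieldNormedType.Exports.
Local Open Scope classical_set_scope.
Local Open Scope ring_scope.
Set Implicit Arguments.
Unset Strict Implicit.
Unset Printing Implicit Defensive.

(** The optimal networks converge to E(y | M) for two reasons: the squared risk
    splits orthogonally, and deep networks are dense.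

    Orthogonality.  Let s be the sup norm of f.  Almost surely the coordinates
    of y, hence those of g = E(y | M), are bounded by s, and truncated networks
    are bounded by s as well.  As y - g is orthogonal to every bounded function
    of M, the risk of a network h is E|y - g|^2 + E|g - h(M)|^2
    ([averages_to_pythagoras]).  A minimizer of the risk is therefore a
    minimizer of the excess E|g - h(M)|^2, and it is enough to exhibit, for
    every large depth, one network with small excess ([excess_small]).  Since
    truncation at s is 1-Lipschitz and fixes g, the excess is at most a constant
    times the L1 distance from g to the network before truncation, so density in
    L1 is all that is needed.

    Density.  Three consecutive layers can simulate one step of a machine that
    has two registers, an accumulator and a scratch vector, and that can read
    any entry of the input X: a bias emits the basis vector e_j, the next layer
    reads an entry of X e_j, and the third one updates the accumulator
    ([run_block]).  The accumulator only has to survive three layers, so a level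
    of at least 3 is enough, and 2n + 1 >= 3.  Such programs compute, coordinate
    by coordinate, all linear combinations of the bumps
      max(1 - \sum_c max(c(X), 0), 0),
    where c ranges over a finite list of affine functions of one entry of X
    ([realizable_bump]).  The weights are bounded by 1, but large coefficients
    and steep slopes are obtained by repeating a program, because depth is free.
    When each constraint is repeated k times and k grows, a bump tends to the
    indicator of the polyhedron where all the c are nonpositive ([cvg_bump]).
    These polyhedra form a pi-system that generates the Borel sets of matrices,
    so the pi-lambda theorem puts the indicators of all events of the
    sigma-algebra of M in the L1 closure of the networks, and simple functions
    do the rest ([L1_closure_integrable], [net_scalar_L1_dense]). *)

(** * Layers with prescribed weights *)

Section gadgets.
Variables (R : realType) (n K : nat).
Local Notation one_layer := (net_param R n 1 K).

Definition unit_vec (p : nat) : 'cV[R]_n := \col_i (i == p :> nat)%:R.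

Lemma norm2Z_unit_vec (a : R) (p : nat) : `|a| <= 1 -> norm2 (a *: unit_vec p) <= 1.
Proof.
move=> a1; rewrite /norm2 -sqrtr1 ler_wsqrtr//.
under eq_bigr do rewrite !mxE exprMn.
have [pn|np] := ltnP p n; last first.
  rewrite big1 ?ler01// => i _.
  by rewrite (ltn_eqF (leq_trans (ltn_ord i) np)) expr0n mulr0.
rewrite (bigD1 (Ordinal pn))//= eqxx expr1n mulr1 big1 => [|i]; last first.
  by rewrite -val_eqE/= => /negbTE ->; rewrite expr0n mulr0.
by rewrite addr0 -real_normK ?num_real// expr_le1.
Qed.

Lemma norm2_unit_vec (p : nat) : norm2 (unit_vec p) <= 1.
Proof. by rewrite -[unit_vec p]scale1r norm2Z_unit_vec// normr1. Qed.

Lemma norm2_0 : norm2 (0 : 'cV[R]_n) <= 1.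
Proof. by rewrite -(scale0r (unit_vec 0)) norm2Z_unit_vec// normr0. Qed.

(** Coefficient of the identity in the weight that multiplies the output k + 1
    layers back; only the latest output (k = 0) and the one three layers back
    (k = 2) are ever used. *)
Definition gadget_lin (c lam gam : R) (i : 'I_2) (k : nat) : R :=
  if k == 0 then (if i == 0 then c else 0)
  else if k == 2 then (if i == 0 then lam else gam) else 0.

Definition gadget_quad (be : R) (i : 'I_2) (k : nat) : R :=
  if (k == 0) && (i != 0) then be else 0.

(** The first n outer products are multiples of e_r e_r^T and add up to a scalar
    matrix, which is the weight A; the next one is a multiple of e_p e_q^T, which
    is the weight B and reads entry q of X h.  Both have factors of norm at most
    1 as soon as the scalars are at most 1 in absolute value. *)
Definition gadget (b0 b1 : 'cV[R]_n) (c lam gam be : R) (p q : nat) : one_layer :=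
  NetParam (fun _ i => if i == 0 then b0 else b1)
    (fun _ i k r =>
       if (r./2 < n)%N then
         if odd r then unit_vec r./2 else gadget_lin c lam gam i k *: unit_vec r./2
       else if r./2 == n then
         if odd r then unit_vec q else gadget_quad be i k *: unit_vec p
       else 0).

Lemma gadget_param_set b0 b1 c lam gam be p q :
  norm2 b0 <= 1 -> norm2 b1 <= 1 -> `|c| <= 1 -> `|lam| <= 1 -> `|gam| <= 1 ->
  `|be| <= 1 -> param_set (gadget b0 b1 c lam gam be p q).
Proof.
move=> b01 b11 c1 lam1 gam1 be1; split=> /= [_ i|_ i k r]; first by case: ifP.
have norm0 : `|0 : R| <= 1 by rewrite normr0.
case: ifP => _; first case: ifP => _; rewrite ?norm2_unit_vec//.
  by apply: norm2Z_unit_vec; rewrite /gadget_lin; do !case: ifP.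
case: ifP => _; last exact: norm2_0.
case: ifP => _; first exact: norm2_unit_vec.
by apply: norm2Z_unit_vec; rewrite /gadget_quad; case: ifP.
Qed.

Section gadget_layer.
Variables (b0 b1 : 'cV[R]_n) (c lam gam be : R) (p q : 'I_n).
Let t := gadget b0 b1 c lam gam be p q.

Lemma outer_gadget l k i (r : 'I_(2 * n)) :
  outer t l k i r =
  if (r < n)%N then gadget_lin c lam gam i k *: unit_vec r *m (unit_vec r)^T
  else if r == n :> nat then
    gadget_quad be i k *: unit_vec p *m (unit_vec q)^T
  else 0.
Proof.
have half_even : (2 * r)./2 = r by rewrite mul2n doubleK.
have half_odd : (2 * r + 1)./2 = r by rewrite mul2n addn1 -uphalfE uphalf_double.
rewrite /outer [theta_weight]lock /= -lock /gadget/= half_even half_odd.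
rewrite oddD oddM /=.
by case: ifP => // _; case: ifP => // _; rewrite mul0mx.
Qed.

Lemma gadget_weightA l k i : weightA t l k i = (gadget_lin c lam gam i k)%:M.
Proof.
pose E r : 'M[R]_n := gadget_lin c lam gam i k *: unit_vec r *m (unit_vec r)^T.
rewrite /weightA (eq_bigr (fun r : 'I_(2 * n) => E r)) => [|r rn]; last first.
  by rewrite outer_gadget rn.
rewrite -(big_ord_widen _ E) ?leq_pmull//.
apply/matrixP => x y; rewrite summxE !mxE (bigD1 x)//= big1 => [|r rx].
  rewrite addr0 /E -scalemxAl !mxE big_ord1 !mxE eqxx mul1r eq_sym.
  by rewrite mulr_natr.
rewrite /E -scalemxAl !mxE big_ord1 !mxE.
by rewrite eq_sym val_eqE (negbTE rx) mul0r mulr0.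
Qed.

Lemma gadget_weightB l k i :
  weightB t l k i = gadget_quad be i k *: (unit_vec p *m (unit_vec q)^T).
Proof.
have n_gt0 : (0 < n)%N by apply: leq_trans (ltn_ord p).
have n2n : (n < 2 * n)%N by rewrite mul2n -addnn -addn1 leq_add2l.
rewrite /weightB (bigD1 (Ordinal n2n))/= ?leqnn// big1 ?addr0; last first.
  move=> r /andP[nr rn]; rewrite outer_gadget ltnNge nr /=.
  by rewrite -val_eqE/= in rn; rewrite (negbTE rn).
by rewrite outer_gadget ltnn eqxx scalemxAl.
Qed.

Lemma layer_gadget (K_gt2 : (2 < K)%N) (X : 'M[R]_n) (hs : seq 'cV[R]_n) l :
  layer t X hs l =
  b0 + (c *: nth 0 hs 0 + lam *: nth 0 hs 2) +
  relu (b1 + (gam *: nth 0 hs 2 + (be * (X *m nth 0 hs 0) q 0) *: unit_vec p)).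
Proof.
have aff i : affine t X hs l i = (if i == 0 then b0 else b1) +
    (gadget_lin c lam gam i 0 *: nth 0 hs 0 + gadget_lin c lam gam i 2 *: nth 0 hs 2 +
     (gadget_quad be i 0 * (X *m nth 0 hs 0) q 0) *: unit_vec p).
  rewrite /affine/=; congr (_ + _).
  pose G k := gadget_lin c lam gam i k *: nth 0 hs k +
    (gadget_quad be i k * (X *m nth 0 hs k) q 0) *: unit_vec p.
  rewrite (eq_bigr (fun k : 'I_K => G k)) => [|k _]; last first.
    rewrite gadget_weightA gadget_weightB mul_scalar_mx; congr (_ + _).
    rewrite -!scalemxAl -scalerA; congr (_ *: _).
    rewrite -!mulmxA; set u := X *m _.
    apply/matrixP => x y; rewrite !mxE big_ord1 !mxE (ord1 y).
    rewrite (bigD1 q)//= big1 => [|r rq]; last by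
      rewrite !mxE val_eqE (negbTE rq) mul0r.
    by rewrite !mxE eqxx mul1r addr0 mulrC.
  rewrite -(big_mkord xpredT G) (big_ltn (leq_trans _ K_gt2))//.
  rewrite (big_ltn (leq_trans _ K_gt2))// (big_ltn K_gt2) big_nat big1 => [|k /andP[k2 _]].
    rewrite /G /gadget_lin /gadget_quad/= !scale0r !mul0r !scale0r !addr0 add0r.
    by rewrite addrAC.
  have [k0 k2'] : (k == 0 = false) /\ (k == 2 = false) by split; apply/gtn_eqF/(leq_trans _ k2).
  by rewrite /G /gadget_lin /gadget_quad/= k0 k2' !scale0r mul0r scale0r addr0.
rewrite /layer !aff /gadget_lin /gadget_quad /= mul0r !scale0r addr0 add0r.
by [].
Qed.

End gadget_layer.
End gadgets.

(** * Networks as register machines *)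

Section programs.
Variables (R : realType) (n K : nat).
Local Notation one_layer := (net_param R n 1 K).
Local Notation unit_vec := (@unit_vec R n).

Definition zero_layer : one_layer := gadget K 0 0 0 0 0 0 0 0.

(** The default of [nth], returned out of range, satisfies the constraint as
    well, so this says that every layer of s does. *)
Definition admissible (s : seq one_layer) :=
  forall k, param_set (nth zero_layer s k).

Definition run (X : 'M[R]_n) (s : seq one_layer) (hs : seq 'cV[R]_n) :=
  foldl (fun hs t => layer t X hs ord0 :: hs) hs s.

Definition stack (L : nat) (s : seq one_layer) : net_param R n L K :=
  NetParam (fun l => theta_bias (nth zero_layer s l) ord0)
           (fun l => theta_weight (nth zero_layer s l) ord0).

Lemma zero_layer_param_set : param_set zero_layer.
Proof. by apply: gadget_param_set; rewrite ?normr0 ?norm2_0. Qed.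

Lemma admissible_nil : admissible [::].
Proof. by move=> k; rewrite nth_nil; exact: zero_layer_param_set. Qed.

Lemma admissible_cat s1 s2 : admissible s1 -> admissible s2 -> admissible (s1 ++ s2).
Proof. by move=> ok1 ok2 k; rewrite nth_cat; case: ifP. Qed.

Lemma admissible_cons t s : param_set t -> admissible s -> admissible (t :: s).
Proof. by move=> okt oks [|k] /=; [exact: okt|exact: oks]. Qed.

Lemma stack_param_set L s : admissible s -> param_set (stack L s).
Proof. by move=> ok; split=> /= l *; have [] := ok l. Qed.

Lemma run_cat X s1 s2 hs : run X (s1 ++ s2) hs = run X s2 (run X s1 hs).
Proof. exact: foldl_cat. Qed.

(** Depth-one networks serve as single layers: [layer] at position l of a stack is
    convertible to [layer] of the l-th component. *)
Lemma net_stack s X : net (stack (size s) s) X = head 0 (run X s [::]).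
Proof.
rewrite /net /run; congr head.
rewrite -[in RHS](mkseq_nth zero_layer s) /mkseq -val_enum_ord.
elim: (enum _) [::] => //= l e IH hs; exact: IH.
Qed.

Lemma relu0 : relu (0 : 'cV[R]_n) = 0.
Proof. by apply/matrixP => i j; rewrite !mxE maxxx. Qed.

Lemma reluZ_unit_vec (x : R) p :
  relu (x *: unit_vec p) = Num.max x 0 *: unit_vec p.
Proof.
apply/matrixP => i j; rewrite !mxE.
by case: (_ == _); rewrite ?mulr0 ?maxxx// !mulr1.
Qed.

Lemma mulmx_unit_vec (X : 'M[R]_n) (i j : 'I_n) : (X *m unit_vec j) i 0 = X i j.
Proof.
rewrite !mxE (bigD1 j)//= big1 => [|k kj]; first by rewrite !mxE eqxx mulr1 addr0.
by rewrite !mxE val_eqE (negbTE kj) mulr0.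
Qed.

Hypothesis K_gt2 : (2 < K)%N.

(** One step of the register machine.  The latest output is the accumulator and
    the one before it the scratch register.  The first layer emits e_j, so that
    the second can read entry (i, j) of X while it updates the scratch register;
    the third one carries the accumulator over from three layers back and adds c
    times the new scratch value. *)
Definition block (p i j : 'I_n) (al be lam gam c : R) : seq one_layer :=
  [:: gadget K (unit_vec j) 0 0 0 0 0 p p;
      gadget K 0 (al *: unit_vec p) 0 lam gam be p i;
      gadget K 0 0 c 1 0 0 p p].

Lemma admissible_block p i j al be lam gam c :
  `|al| <= 1 -> `|be| <= 1 -> `|lam| <= 1 -> `|gam| <= 1 -> `|c| <= 1 ->
  admissible (block p i j al be lam gam c).
Proof.
move=> *; do 3!(apply: admissible_cons; first by
  apply: gadget_param_set; rewrite ?normr0 ?normr1 ?norm2_0 ?norm2_unit_vec ?norm2Z_unit_vec).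
exact: admissible_nil.
Qed.

Lemma run_block (p i j : 'I_n) (al be lam gam c : R) (X : 'M[R]_n) hs :
  let hs' := run X (block p i j al be lam gam c) hs in
  let v := lam *: nth 0 hs 1 +
           relu (gam *: nth 0 hs 1 + (al + be * X i j) *: unit_vec p) in
  nth 0 hs' 0 = nth 0 hs 0 + c *: v /\ nth 0 hs' 1 = v.
Proof.
move=> hs' v.
have layer_w : layer (gadget K (unit_vec j) 0 0 0 0 0 p p) X hs ord0 = unit_vec j.
  by rewrite layer_gadget// !scale0r !add0r mul0r scale0r relu0 !addr0.
have hs'1 : nth 0 hs' 1 = v.
  rewrite /hs' /= layer_w layer_gadget// !add0r /= mulmx_unit_vec scale0r add0r.
  by rewrite addrCA -scalerDl.
split=> //; rewrite -hs'1 /hs' /= [LHS]layer_gadget//=.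
by rewrite scale0r mul0r scale0r !add0r relu0 addr0 scale1r addrC.
Qed.

(** The program has to add v X to whatever accumulator it finds in the history;
    sums of realizable functions are then realized by concatenating programs. *)
Definition realizable (v : 'M[R]_n -> 'cV[R]_n) :=
  exists2 s, admissible s &
    forall X hs, nth 0 (run X s hs) 0 = nth 0 hs 0 + v X.

Lemma realizable0 : realizable (fun=> 0).
Proof. by exists [::]; [exact: admissible_nil|move=> X hs /=; rewrite addr0]. Qed.

Lemma realizableD v1 v2 :
  realizable v1 -> realizable v2 -> realizable (fun X => v1 X + v2 X).
Proof.
move=> [s1 ok1 run1] [s2 ok2 run2]; exists (s1 ++ s2); first exact: admissible_cat.
by move=> X hs; rewrite run_cat run2 run1 addrA.
Qed.

Lemma realizable_sum (I : Type) (r : seq I) (v : I -> 'M[R]_n -> 'cV[R]_n) :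
  (forall i, realizable (v i)) -> realizable (fun X => \sum_(i <- r) v i X).
Proof.
move=> rv; elim: r => [|i r IH].
  by under eq_fun do rewrite big_nil; exact: realizable0.
by under eq_fun do rewrite big_cons; exact: realizableD.
Qed.

(** A depth larger than the length of the program is reached by putting zero
    layers in front: a history of zero vectors is indistinguishable from the
    empty history, since missing outputs are read as 0. *)
Lemma realizable_net v : realizable v -> exists L0, forall L, (L0 <= L)%N ->
  exists2 t : net_param R n L K, param_set t & forall X, net t X = v X.
Proof.
move=> [s oks runs]; exists (size s) => L sL.
pose s' := nseq (L - size s) zero_layer ++ s.
have sizes' : size s' = L by rewrite size_cat size_nseq subnK.
exists (stack L s').
  apply: stack_param_set; apply: admissible_cat oks => k.
  by rewrite nth_nseq; case: ifP => _; exact: zero_layer_param_set.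
move=> X; rewrite -sizes' net_stack run_cat -nth0 runs.
have zeros m hs : (forall k, nth 0 hs k = 0) ->
    forall k, nth 0 (run X (nseq m zero_layer) hs) k = 0.
  elim: m hs => //= m IH hs hs0; apply: IH => -[|k] //=.
  have [n0|n_gt0] := posnP n.
    by apply/matrixP => i; have := ltn_ord i; rewrite [X in (_ < X)%N]n0.
  pose o := Ordinal n_gt0.
  rewrite (layer_gadget _ _ _ _ _ _ o o)//.
  by rewrite !hs0 !scaler0 !add0r mulmx0 !mxE mulr0 scale0r relu0.
by rewrite zeros ?add0r// => k; rewrite nth_nil.
Qed.

(* The affine function X |-> al + be * X i j of one entry is coded
   ((al, be), (i, j)). *)
Local Notation constraint := ((R * R) * ('I_n * 'I_n))%type.

Definition affine_entry (c : constraint) (X : 'M[R]_n) : R :=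
  c.1.1 + c.1.2 * X c.2.1 c.2.2.

(** A continuous surrogate for the indicator of the polyhedron on which all the
    functions of s are nonpositive: it is 1 there and decreases with the total
    violation of the constraints. *)
Definition bump (s : seq constraint) (X : 'M[R]_n) : R :=
  Num.max (1 - \sum_(c <- s) Num.max (affine_entry c X) 0) 0.

Definition small (c : constraint) := (`|c.1.1| <= 1) && (`|c.1.2| <= 1).

(** The scratch register is cleared, it collects the violation of one constraint
    after the other in its coordinate p, and a last step rectifies 1 minus this
    sum and adds a times the result to the accumulator. *)
Lemma realizable_small_bump (p : 'I_n) (s : seq constraint) (a : R) :
  all small s -> `|a| <= 1 -> realizable (fun X => (a * bump s X) *: unit_vec p).
Proof.
move=> smalls a1.
pose penalty (c : constraint) := block p c.2.1 c.2.2 c.1.1 c.1.2 1 0 0.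
pose final := block p p p 1 0 0 (-1) a.
have ok_pen : admissible (flatten (map penalty s)).
  elim: s smalls => /= [_|c s IH /andP[/andP[c1 c2] cs]]; first exact: admissible_nil.
  apply: (@admissible_cat (penalty c)); last exact: IH.
  by apply: admissible_block; rewrite ?normr0 ?normr1.
exists (block p p p 0 0 0 0 0 ++ flatten (map penalty s) ++ final).
  apply: admissible_cat; first by apply: admissible_block; rewrite normr0.
  apply: admissible_cat => //.
  by apply: admissible_block; rewrite ?normrN ?normr0 ?normr1.
move=> X hs; rewrite !run_cat.
have [] := run_block p p p 0 0 0 0 0 X hs.
set hs0 := run X _ hs.
rewrite !scale0r !add0r mul0r scale0r relu0 addr0 => hs0_acc hs0_pen.
have pens : forall (s' : seq constraint) (hs1 : seq 'cV[R]_n) x,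
    nth 0 hs1 1 = x *: unit_vec p ->
    let hs2 := run X (flatten (map penalty s')) hs1 in
    nth 0 hs2 0 = nth 0 hs1 0 /\
    nth 0 hs2 1 = (x + \sum_(c <- s') Num.max (affine_entry c X) 0) *: unit_vec p.
  elim=> [|c s' IH] hs1 x hs1_pen; first by rewrite big_nil addr0.
  have [] := run_block p c.2.1 c.2.2 c.1.1 c.1.2 1 0 0 X hs1.
  rewrite scale0r addr0 hs1_pen scale1r scale0r add0r reluZ_unit_vec -scalerDl.
  move=> acc /IH[hs2_acc hs2_pen] hs2.
  have -> : hs2 = run X (flatten (map penalty s')) (run X (penalty c) hs1).
    by rewrite -run_cat.
  rewrite hs2_acc hs2_pen; split=> //.
  by rewrite big_cons addrA.
have [] := pens s hs0 0; first by rewrite scale0r.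
set hs1 := run X _ hs0; rewrite add0r => hs1_acc hs1_pen.
have [-> _] := run_block p p p 1 0 0 (-1) a X hs1.
rewrite hs1_acc hs0_acc hs1_pen mul0r addr0 scale0r add0r scalerA -scalerDl.
by rewrite mulN1r (addrC (- _)) reluZ_unit_vec scalerA.
Qed.

(** A coefficient larger than 1 is split into equal parts that are small enough to
    be weights, and the program is repeated. *)
Lemma realizable_bump (p : 'I_n) (s : seq constraint) (a : R) :
  all small s -> realizable (fun X => (a * bump s X) *: unit_vec p).
Proof.
move=> smalls.
have [m am] : exists m : nat, `|a| <= m.+1%:R.
  exists (Num.trunc `|a|); exact/ltW/truncnS_gt.
have -> : (fun X => (a * bump s X) *: unit_vec p) =
    fun X => \sum_(k <- iota 0 m.+1) ((a / m.+1%:R) * bump s X) *: unit_vec p.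
  apply/funext => X; rewrite -scaler_suml -mulr_suml big_const_seq count_predT size_iota.
  by rewrite iter_addr addr0 -(mulr_natr (a / m.+1%:R)) divfK// pnatr_eq0.
apply: realizable_sum => _; apply: realizable_small_bump => //.
by rewrite normrM normfV normr_nat ler_pdivrMr// mul1r.
Qed.

End programs.

(** * Measurability of matrix-valued maps *)

Section matrix_measurability.
Variables (R : realType) (m n : nat).

Definition rational_box (c : 'M[rat]_(m, n) * nat) : set 'M[R]_(m, n) :=
  [set A | forall i j, ball (ratr (c.1 i j) : R) c.2.+1%:R^-1 (A i j)].

(** Second countability of the space of matrices, which reduces measurability for
    its Borel sets to measurability of the entries. *)
Lemma open_bigcup_rational_box (U : set 'M[R]_(m, n)) : open U ->
  U = \bigcup_c [set A | rational_box c `<=` U /\ rational_box c A].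
Proof.
move=> oU; apply/seteqP; split; last by move=> A [c _ [cU cA]]; exact: cU.
move=> A UA; have [e e0 eU] : exists2 e : R, 0 < e & ball A e `<=` U.
  by have /nbhs_ballP[e /= e0 eU] := open_nbhs_nbhs (conj oU UA); exists e.
have [k ke] : exists k : nat, k.+1%:R^-1 < e / 2.
  exists (Num.trunc (e / 2)^-1); rewrite invf_plt ?posrE ?divr_gt0//.
  exact: truncnS_gt.
have k0 : (0 : R) < k.+1%:R^-1 by rewrite invr_gt0.
set r : R := k.+1%:R^-1 in ke k0 *.
have ratA i j : exists q : rat, ball (ratr q : R) r (A i j).
  have [|q] := @rat_in_itvoo R (A i j - r) (A i j + r); first lra.
  rewrite in_itv/= => /andP[h1 h2]; exists q; rewrite /ball/= ltr_distlC.
  by apply/andP; split; lra.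
have [q qA] := choice (fun ij : 'I_m * 'I_n => ratA ij.1 ij.2).
exists (\matrix_(i, j) q (i, j), k) => //; split=> [B cB|i j] /=; last first.
  by rewrite mxE; exact: (qA (i, j)).
apply: eU; split=> // i j; have := cB i j; have := qA (i, j).
rewrite /ball/= mxE -/r => h1 h2.
rewrite (_ : A i j - B i j = (ratr (q (i, j)) - B i j) - (ratr (q (i, j)) - A i j));
  last by ring.
by rewrite (le_lt_trans (ler_normB _ _))//; lra.
Qed.

Lemma measurable_fun_mx d (T : measurableType d) (h : T -> borelType 'M[R]_(m, n)) :
  (forall i j, measurable_fun [set: T] (fun w => h w i j)) ->
  measurable_fun [set: T] h.
Proof.
move=> mh; apply: (@measurability _ _ T (borelType 'M[R]_(m, n)) setT h open erefl).
move=> _ [U oU <-]; rewrite setTI.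
rewrite (open_bigcup_rational_box oU) preimage_bigcup.
apply: countable_bigcupT_measurable => [|c]; first exact: countableP.
have [cU|cU] := pselect (rational_box c `<=` U); last first.
  rewrite (_ : _ @^-1` _ = set0) //.
  by apply/seteqP; split=> // w [].
rewrite (_ : _ @^-1` _ =
  \bigcap_(ij in [set: 'I_m * 'I_n])
    (fun w => h w ij.1 ij.2) @^-1` (ball (ratr (c.1 ij.1 ij.2) : R) c.2.+1%:R^-1)).
  apply: fin_bigcap_measurable => // -[i j] _.
  rewrite -[X in measurable X]setTI; apply: mh => //.
  exact: measurable_realfun.measurable_ball.
apply/seteqP; split=> [w [_ cw] [i j] _|w cw]; first exact: cw.
by split=> // i j; exact: (cw (i, j)).
Qed.

Lemma measurable_coord i j :
  measurable_fun [set: borelType 'M[R]_(m, n)] (fun A : borelType 'M[R]_(m, n) => A i j).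
Proof.
apply: (measurability _ (measurable_realfun.RGenOpens.measurableE R)) => _ [_ [a [b ->]] <-].
rewrite setTI; apply: sub_sigma_algebra.
have /continuousP := @coord_continuous R m n i j.
by apply; exact: interval_open.
Qed.

End matrix_measurability.

(** * Dense subspaces of L1 *)

Section L1_density.
Context d (T : measurableType d) (R : realType).
Variable mu : {finite_measure set T -> \bar R}.

(** Extended-real valued, hence meaningful for all measurable functions. *)
Definition L1_dist (f g : T -> R) : \bar R := (\int[mu]_x `|f x - g x|%:E)%E.

Definition L1_closure (V : set (T -> R)) : set (T -> R) :=
  [set f | measurable_fun setT f /\
    forall e, 0 < e -> exists2 v, V v & (L1_dist f v <= e%:E)%E].

Lemma measurable_fun_distance (f g : T -> R) : measurable_fun setT f ->
  measurable_fun setT g -> measurable_fun setT (fun x => `|f x - g x|%:E : \bar R).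
Proof.
move=> mf mg; apply/measurable_EFinP/measurableT_comp => //.
exact: measurable_funB.
Qed.

Lemma L1_dist_triangle (f g h : T -> R) : measurable_fun setT f ->
  measurable_fun setT g -> measurable_fun setT h ->
  (L1_dist f h <= L1_dist f g + L1_dist g h)%E.
Proof.
move=> mf mg mh; rewrite /L1_dist -ge0_integralD//; try exact: measurable_fun_distance.
apply: ge0_le_integral => //; first exact: measurable_fun_distance.
  by apply: emeasurable_funD; exact: measurable_fun_distance.
by move=> x _; rewrite -EFinD lee_fin ler_distD.
Qed.

Lemma dominated_cvg_L1 (u : nat -> T -> R) (f : T -> R) (C : R) :
  (forall k, measurable_fun setT (u k)) -> (forall k x, `|u k x| <= C) ->
  (forall x, u ^~ x @ \oo --> f x) ->
  measurable_fun setT f /\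
  forall e, 0 < e -> exists k, (L1_dist f (u k) <= e%:E)%E.
Proof.
move=> mu_ uC uf.
have mf : measurable_fun setT f.
  by apply: (measurable_fun_cvg (h := u)) => // x _; exact: uf.
split=> // e e0.
have [] := @dominated_convergence _ _ _ mu _ measurableT
  (fun k => EFin \o u k) (EFin \o f) (cst C%:E).
- by move=> k; exact/measurable_EFinP.
- exact/measurable_EFinP.
- by apply: aeW => x _; apply: cvg_EFin; [exact: nearW|exact: uf].
- exact: finite_measure_integrable_cst.
- by apply: aeW => x k _; rewrite lee_fin.
move=> _ /fine_cvgP[fin /cvgrPdist_le /(_ _ e0) small] _.
have [k [fk sk]] := filter_ex (filterI fin small).
exists k; rewrite /L1_dist; under eq_integral do rewrite distrC.
move: sk; rewrite sub0r normrN /= -lee_fin ger0_norm ?fine_ge0 ?integral_ge0//.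
by rewrite fineK.
Qed.

Section closure.
Variable V : set (T -> R).
Hypothesis V_meas : forall v, V v -> measurable_fun setT v.
Hypothesis VD : forall v w, V v -> V w -> V (fun x => v x + w x).
Hypothesis VZ : forall c v, V v -> V (fun x => c * v x).

Lemma L1_closure_id v : V v -> L1_closure V v.
Proof.
move=> Vv; split=> [|e e0]; first exact: V_meas.
exists v => //; rewrite /L1_dist.
under eq_integral do rewrite subrr normr0.
by rewrite integral0 lee_fin ltW.
Qed.

Lemma L1_closureD f g : L1_closure V f -> L1_closure V g ->
  L1_closure V (fun x => f x + g x).
Proof.
move=> [mf fV] [mg gV]; split=> [|e e0]; first exact: measurable_funD.
have e20 : 0 < e / 2 by rewrite divr_gt0.
have [v Vv fv] := fV _ e20; have [w Vw gw] := gV _ e20.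
exists (fun x => v x + w x); first exact: VD.
rewrite [e]splitr EFinD; apply: le_trans (leeD fv gw).
have mv := V_meas Vv; have mw := V_meas Vw.
rewrite /L1_dist -ge0_integralD//; try exact: measurable_fun_distance.
apply: ge0_le_integral => //.
- by apply: measurable_fun_distance; exact: measurable_funD.
- by apply: emeasurable_funD; exact: measurable_fun_distance.
- move=> x _; rewrite -EFinD lee_fin opprD addrACA; exact: ler_normD.
Qed.

Lemma L1_closureZ c f : L1_closure V f -> L1_closure V (fun x => c * f x).
Proof.
move=> [mf fV]; split=> [|e e0]; first exact: measurable_funM.
have c0 : 0 < `|c| + 1 by rewrite ltr_wpDl.
have [v Vv fv] := fV (e / (`|c| + 1)) ltac:(by rewrite divr_gt0).
exists (fun x => c * v x); first exact: VZ.
apply: le_trans (_ : ((`|c| + 1)%:E * L1_dist f v <= _)%E); last first.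
  apply: le_trans (lee_wpmul2l _ fv) _; first by rewrite lee_fin ltW.
  by rewrite -EFinM mulrCA divff ?mulr1// gt_eqF.
have mv := V_meas Vv.
rewrite /L1_dist -ge0_integralZl_EFin//; last exact: measurable_fun_distance.
apply: ge0_le_integral => //.
- by apply: measurable_fun_distance; exact: measurable_funM.
- by apply: measurable_funeM; exact: measurable_fun_distance.
- by move=> x _; rewrite -EFinM lee_fin -mulrBr normrM ler_wpM2r// lerDl.
Qed.

Lemma L1_closure_closed f : measurable_fun setT f ->
  (forall e, 0 < e -> exists2 g, L1_closure V g & (L1_dist f g <= e%:E)%E) ->
  L1_closure V f.
Proof.
move=> mf fV; split=> // e e0.
have e20 : 0 < e / 2 by rewrite divr_gt0.
have [g [mg gV] fg] := fV _ e20; have [v Vv gv] := gV _ e20.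
exists v => //; rewrite [e]splitr EFinD; apply: le_trans (leeD fg gv).
by apply: L1_dist_triangle => //; exact: V_meas.
Qed.

Lemma L1_closure_bounded_cvg (u : nat -> T -> R) (f : T -> R) (C : R) :
  (forall k, L1_closure V (u k)) -> (forall k x, `|u k x| <= C) ->
  (forall x, u ^~ x @ \oo --> f x) -> L1_closure V f.
Proof.
move=> uV uC uf.
have [mf fu] := dominated_cvg_L1 (fun k => (uV k).1) uC uf.
apply: L1_closure_closed => // e /fu[k fk]; by exists (u k).
Qed.

Variable G : set (set T).
Hypothesis setIG : setI_closed G.
Hypothesis GT : G setT.
Hypothesis genG : @measurable _ T `<=` <<s G>>.
Hypothesis GV : forall A, G A -> L1_closure V \1_A.

(** The sets whose indicator is in the closure form a lambda-system: differences
    come from linearity and increasing unions from dominated convergence. *)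
Lemma L1_closure_indic (A : set T) : measurable A -> L1_closure V \1_A.
Proof.
pose D := [set A : set T | L1_closure V \1_A].
suff lamD : lambda_system setT D.
  by move=> /genG; apply: (lambda_system_subset setIG lamD) => //.
split=> //.
- exact: GV.
- move=> {}A B BA DA DB; rewrite /D/= (_ : \1_(A `\` B) =
    (fun x => \1_A x + (- 1) * \1_B x : R)); first exact: L1_closureD _ (L1_closureZ _ _).
  apply/funext => x; rewrite !indicE in_setD mulN1r.
  have [Bx|] := boolP (x \in B); last by rewrite andbT subr0.
  by rewrite andbF (mem_set (BA _ (set_mem Bx))) subrr.
- move=> F ndF DF.
  apply: (@L1_closure_bounded_cvg (fun k => \1_(F k)) _ 1) => [k|k x|x].
  + exact: DF.
  + by rewrite indicE; case: (_ \in _); rewrite ?normr1 ?normr0.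
  + have [[k _ Fkx]|nFx] := pselect ((\bigcup_k F k) x).
      apply: cvg_near_cst; exists k => // l /= kl.
      have /subsetPset Fkl := ndF k l kl.
      rewrite !indicE !mem_set//; first by exists k.
      exact: Fkl.
    rewrite [X in _ --> X]indicE memNset//; apply: cvg_near_cst; apply: nearW => l.
    by rewrite indicE memNset// => Flx; apply: nFx; exists l.
Qed.

Import HBSimple.

Lemma L1_closure_sfun (h : {sfun T >-> R}) : L1_closure V h.
Proof.
have [s ->] : exists s : seq R,
    (h : T -> R) = (fun x => \sum_(y <- s) y * \1_(h @^-1` [set y]) x).
  eexists; apply/funext => x; rewrite [LHS]fimfunE fsbig_finite//; exact: fimfunP.
elim: s => [|y s IH].
  rewrite (_ : (fun _ => _) = fun x => 0 * \1_[set: T] x).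
    exact: L1_closureZ (GV GT).
  by apply/funext => x; rewrite big_nil mul0r.
rewrite (_ : (fun _ => _) = fun x =>
  y * \1_(h @^-1` [set y]) x + \sum_(z <- s) z * \1_(h @^-1` [set z]) x).
  apply: L1_closureD IH; apply: L1_closureZ; exact: L1_closure_indic.
by apply/funext => x; rewrite big_cons.
Qed.

(** Simple functions are combinations of indicators and are dense in L1, and the
    closure is closed. *)
Theorem L1_closure_integrable (f : T -> R) :
  mu.-integrable setT (EFin \o f) -> L1_closure V f.
Proof.
move=> intf; have mf : measurable_fun setT f.
  by apply/measurable_EFinP; case/integrableP: intf.
have [h [_ _ /fine_cvgP[fin /cvgrPdist_le small]]] :=
  approximation_sfun_integrable measurableT intf.
apply: L1_closure_closed => // e e0.
have [k [fk sk]] := filter_ex (filterI fin (small _ e0)).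
exists (h k); first exact: L1_closure_sfun.
move: sk; rewrite sub0r normrN /= -lee_fin ger0_norm ?fine_ge0 ?integral_ge0//.
by rewrite fineK.
Qed.

End closure.
End L1_density.

(** * Realizable functions are dense in L1 *)

Section bumps.
Variables (R : realType) (n K : nat).
Hypothesis K_gt2 : (2 < K)%N.
Local Notation constraint := ((R * R) * ('I_n * 'I_n))%type.

Definition feasible (s : seq constraint) : set 'M[R]_n :=
  [set X | all (fun c => affine_entry c X <= 0) s].

Lemma bump_ge0 (s : seq constraint) (X : 'M[R]_n) : 0 <= bump s X.
Proof. by rewrite /bump le_max lexx orbT. Qed.

Lemma penalty_ge0 (s : seq constraint) (X : 'M[R]_n) :
  0 <= \sum_(c <- s) Num.max (affine_entry c X) 0.
Proof. by apply: sumr_ge0 => c _; rewrite le_max lexx orbT. Qed.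

Lemma bump_le1 (s : seq constraint) (X : 'M[R]_n) : bump s X <= 1.
Proof. by rewrite /bump ge_max ler01 andbT gerBl penalty_ge0. Qed.

Lemma penalty_eq0 (s : seq constraint) (X : 'M[R]_n) :
  \sum_(c <- s) Num.max (affine_entry c X) 0 = 0 <-> feasible s X.
Proof.
rewrite /feasible/=; elim: s => [|c s IH]; first by rewrite big_nil.
rewrite big_cons /=; split=> [|/andP[cX /IH ->]]; last by rewrite max_r ?addr0.
move=> /eqP; rewrite paddr_eq0 ?penalty_ge0 ?le_max ?lexx ?orbT// => /andP[/eqP c0 /eqP s0].
by apply/andP; split; [rewrite -c0 le_max lexx|exact/IH].
Qed.

(** Repeating the list of constraints k times multiplies the violation by k, so
    that the bump vanishes for large k wherever the violation is positive. *)
Lemma cvg_bump (s : seq constraint) (X : 'M[R]_n) :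
  bump (flatten (nseq k s)) X @[k --> \oo] --> (\1_(feasible s) X : R).
Proof.
set pen := \sum_(c <- s) Num.max (affine_entry c X) 0.
have bumpE k : bump (flatten (nseq k s)) X = Num.max (1 - pen *+ k) 0.
  rewrite /bump; congr (Num.max (1 - _) _).
  by elim: k => [|k IH] /=; rewrite ?big_nil ?mulr0n// big_cat/= IH mulrS.
have [fX|nfX] := pselect (feasible s X).
  rewrite indicE mem_set//; apply: cvg_near_cst; apply: nearW => k.
  by rewrite bumpE /pen (penalty_eq0 s X).2// mul0rn subr0 max_l.
have pen_gt0 : 0 < pen.
  by rewrite lt_def penalty_ge0 andbT; apply/eqP => /penalty_eq0.
rewrite indicE memNset//; apply: cvg_near_cst.
exists (Num.trunc pen^-1).+1 => // k /= ltk; rewrite bumpE max_r// subr_le0.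
rewrite -mulr_natr -ler_pdivrMl// mulr1 (le_trans (ltW (truncnS_gt _)))//.
by rewrite ler_nat.
Qed.

Lemma measurable_bump (s : seq constraint) :
  measurable_fun [set: borelType 'M[R]_n] (bump s : borelType 'M[R]_n -> R).
Proof.
apply: measurable_maxr => //; apply: measurable_funB => //.
apply: measurable_sum => c; apply: measurable_maxr => //.
apply: measurable_funD => //; apply: measurable_funM => //.
exact: measurable_coord.
Qed.

(** The quantification over all c makes this class stable under scaling by its very
    form, although the weights of the networks are bounded. *)
Definition net_scalar (q : borelType 'M[R]_n -> R) :=
  measurable_fun setT q /\
  forall (p : 'I_n) c, realizable K (fun X => (c * q X) *: unit_vec R n p).

Lemma net_scalarD q1 q2 : net_scalar q1 -> net_scalar q2 ->
  net_scalar (fun X => q1 X + q2 X).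
Proof.
move=> [m1 r1] [m2 r2]; split=> [|p c]; first exact: measurable_funD.
under eq_fun do rewrite mulrDr scalerDl.
exact: realizableD.
Qed.

Lemma net_scalarZ a q : net_scalar q -> net_scalar (fun X => a * q X).
Proof.
move=> [mq rq]; split=> [|p c]; first exact: measurable_funM.
by under eq_fun do rewrite mulrA; exact: rq.
Qed.

Lemma net_scalar_bump (s : seq constraint) : all (@small R n) s -> net_scalar (bump s).
Proof.
by move=> ss; split=> [|p c]; [exact: measurable_bump|exact: realizable_bump].
Qed.

Section density.
Context d (T : measurableType d) (mu : {finite_measure set T -> \bar R}).
Variable M : T -> borelType 'M[R]_n.
Hypothesis M_meas : measurable_fun setT M.
Hypothesis M_gen : @measurable _ T `<=` g_sigma_algebra_preimage M.

Definition feasible_events : set (set T) :=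
  [set A | exists2 s, all (@small R n) s & A = M @^-1` feasible s].

(** The half-spaces X i j <= a are feasible sets, once their equation is divided by
    1 + |a| to make both of its coefficients small. *)
Lemma feasible_events_gen : @measurable _ T `<=` <<s feasible_events>>.
Proof.
move=> _ /M_gen[B mB <-].
pose M' : g_sigma_algebraType feasible_events -> borelType 'M[R]_n := M.
suff mM' : measurable_fun setT M' by exact: (mM' measurableT B mB).
apply: measurable_fun_mx => i j.
apply: (measurability _ (RGenOInfty.measurableE R)) => _ [_ [a ->] <-].
rewrite setTI -[X in measurable X]setCK; apply: measurableC.
apply: sub_sigma_algebra.
have a1 : 0 < 1 + `|a| by rewrite ltr_wpDr.
exists [:: ((- a / (1 + `|a|), (1 + `|a|)^-1), (i, j))].
  rewrite /= /small/= andbT normrM normrN !normfV (gtr0_norm a1).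
  by rewrite ler_pdivrMr// mul1r lerDr ler01/= invf_le1// lerDl.
have aff x : (- a / (1 + `|a|) + (1 + `|a|)^-1 * x <= 0) = (x <= a).
  by rewrite [_^-1 * _]mulrC -mulrDl pmulr_lle0 ?invr_gt0// addrC subr_le0.
apply/funext => w; rewrite /setC /preimage /feasible /affine_entry /mkset /=.
by rewrite in_itv/= !andbT aff leNgt; apply/propext; split=> /negP.
Qed.

Theorem net_scalar_L1_dense (f : T -> R) : mu.-integrable setT (EFin \o f) ->
  L1_closure mu [set q \o M | q in net_scalar] f.
Proof.
apply: (@L1_closure_integrable _ _ _ mu _ _ _ _ feasible_events).
- by move=> _ [q [mq _] <-]; exact: measurableT_comp.
- move=> _ _ [q1 Q1 <-] [q2 Q2 <-].
  by exists (fun X => q1 X + q2 X) => //; exact: net_scalarD.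
- move=> a _ [q Q <-].
  by exists (fun X => a * q X) => //; exact: net_scalarZ.
- move=> _ _ [s1 ss1 ->] [s2 ss2 ->]; exists (s1 ++ s2); first by rewrite all_cat ss1.
  by apply/seteqP; split=> w /=; rewrite /feasible/= all_cat => /andP.
- by exists [::] => //; apply/seteqP; split.
- exact: feasible_events_gen.
- move=> _ [s ss ->].
  apply: (@L1_closure_bounded_cvg _ _ _ mu _ _
    (fun k => bump (flatten (nseq k s)) \o M) _ 1) => [|k|k w|w].
  + by move=> _ [q [mq _] <-]; exact: measurableT_comp.
  + apply: L1_closure_id; first by move=> _ [q [mq _] <-]; exact: measurableT_comp.
    exists (bump (flatten (nseq k s))) => //; apply: net_scalar_bump.
    by elim: k => //= k IH; rewrite all_cat ss.
  + by rewrite ger0_norm ?bump_ge0 ?bump_le1.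
  + exact: cvg_bump.
Qed.

End density.
End bumps.

(** * Conditional expectation of bounded variables *)

Section conditional_expectation.
Context d d' (Omega : measurableType d) (S : measurableType d') (R : realType).
Variables (P : probability Omega R) (X : {RV P >-> S}).

Definition bounded_mfun (f : Omega -> R) :=
  measurable_fun setT f /\ exists C, forall w, `|f w| <= C.

Lemma bounded_mfun_cst c : bounded_mfun (cst c).
Proof. by split=> //; exists `|c|. Qed.

Lemma bounded_mfunD f g : bounded_mfun f -> bounded_mfun g ->
  bounded_mfun (fun w => f w + g w).
Proof.
move=> [mf [C fC]] [mg [D gD]]; split; first exact: measurable_funD.
by exists (C + D) => w; rewrite (le_trans (ler_normD _ _))// lerD.
Qed.

Lemma bounded_mfunM f g : bounded_mfun f -> bounded_mfun g ->
  bounded_mfun (fun w => f w * g w).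
Proof.
move=> [mf [C fC]] [mg [D gD]]; split; first exact: measurable_funM.
by exists (C * D) => w; rewrite normrM ler_pM.
Qed.

Lemma bounded_mfunB f g : bounded_mfun f -> bounded_mfun g ->
  bounded_mfun (fun w => f w - g w).
Proof.
move=> bf [mg [D gD]]; apply: bounded_mfunD => //; split.
  exact: measurable_funN.
by exists D => w; rewrite normrN.
Qed.

Lemma bounded_mfun_norm f : bounded_mfun f -> bounded_mfun (fun w => `|f w|).
Proof.
move=> [mf [C fC]]; split; first exact: measurableT_comp.
by exists C => w; rewrite normr_id.
Qed.

Lemma bounded_mfun_integrable f (A : set Omega) : bounded_mfun f -> measurable A ->
  P.-integrable A (EFin \o f).
Proof.
move=> [mf [C fC]] mA; apply: measurable_bounded_integrable => //.
- by rewrite (le_lt_trans (probability_le1 _ _))// ltry.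
- exact: measurable_funTS.
- by exists C; split; [exact: num_real|move=> D CD w _; rewrite /= (le_trans (fC w))// ltW].
Qed.

(** G o X is a version of the conditional expectation of y given the sigma-algebra
    that X pulls back from S.  Working with G on S, rather than with G o X on
    Omega, makes measurability with respect to this sigma-algebra a property of
    the function alone. *)
Definition averages_to (y : Omega -> R) (G : S -> R) :=
  forall A : set S, measurable A ->
    \int[P]_(w in X @^-1` A) G (X w) = \int[P]_(w in X @^-1` A) y w.

Lemma measurable_preimage_RV (A : set S) : measurable A -> measurable (X @^-1` A).
Proof. by move=> mA; rewrite -[X in measurable X]setTI; exact: measurable_funP. Qed.

(** On the event where b G(X) exceeds C, the integral of the positive function
    b G(X) - C equals that of b y - C, which is nonpositive; so the event is null.
    The values b = 1 and b = -1 transfer two-sided bounds from y to G(X). *)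
Lemma averages_to_le (y : Omega -> R) (G : S -> R) (b C : R) :
  bounded_mfun y -> measurable_fun setT G -> P.-integrable setT (EFin \o (G \o X)) ->
  averages_to y G -> (forall w, b * y w <= C) -> {ae P, forall w, b * G (X w) <= C}.
Proof.
move=> bdd_y mG iG avg yC.
pose A := [set x | C < b * G x].
have mA : measurable A.
  rewrite (_ : A = (fun x => b * G x) @^-1` `]C, +oo[).
    by rewrite -[X in measurable X]setTI; apply: measurable_funM.
  by apply/seteqP; split=> x /=; rewrite in_itv/= andbT.
have mXA := measurable_preimage_RV mA.
have iGA : P.-integrable (X @^-1` A) (EFin \o (G \o X)) by exact: integrableS iG.
have icA c : P.-integrable (X @^-1` A) (EFin \o cst c).
  exact: bounded_mfun_integrable (bounded_mfun_cst c) _.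
have iyA := bounded_mfun_integrable bdd_y mXA.
have ibGA : P.-integrable (X @^-1` A) (EFin \o (fun w => b * G (X w))).
  exact: integrableZl iGA.
have ibyA : P.-integrable (X @^-1` A) (EFin \o (fun w => b * y w)).
  exact: integrableZl iyA.
have igap : P.-integrable (X @^-1` A) (EFin \o (fun w => b * G (X w) - C)).
  exact: integrableB ibGA (icA C).
have int0 : \int[P]_(w in X @^-1` A) (b * G (X w) - C) <= 0.
  have -> : \int[P]_(w in X @^-1` A) (b * G (X w) - C) =
            \int[P]_(w in X @^-1` A) (b * y w - C).
    rewrite (RintegralB mXA ibGA (icA C)) (RintegralB mXA ibyA (icA C)).
    by rewrite (RintegralZl b mXA iGA) (RintegralZl b mXA iyA) avg.
  have <- : \int[P]_(w in X @^-1` A) 0 = 0 by rewrite Rintegral_cst// mul0r.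
  apply: le_Rintegral => //; [exact: integrableB ibyA (icA C)|exact: icA 0|].
  by move=> w _; rewrite subr_le0.
have /(ae_eq_integral_abs P mXA (measurable_int _ igap)) :
    (\int[P]_(w in X @^-1` A) `|(b * G (X w) - C)%:E| = 0)%E.
  apply/eqP; rewrite eq_le integral_ge0 ?andbT//.
  rewrite -[X in (_ <= X)%E]/(0%:E) -(fineK (integrable_fin_num mXA (integrable_abse igap))).
  rewrite lee_fin; apply: le_trans int0.
  rewrite /Rintegral; apply: fine_le; try exact: integrable_fin_num.
    exact: (integrable_fin_num mXA (integrable_abse igap)).
  rewrite le_eqVlt; apply/orP; left; apply/eqP/eq_integral => w /set_mem /= Aw.
  by rewrite ger0_norm// subr_ge0 ltW.
apply: filterS => w; rewrite /= => h; rewrite leNgt; apply/negP => Aw.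
by have /eqP := h Aw; rewrite eqe subr_eq0 gt_eqF.
Qed.

Lemma bounded_mfun_RV (U : S -> R) (C : R) : measurable_fun setT U ->
  (forall x, `|U x| <= C) -> bounded_mfun (U \o X).
Proof.
by move=> mU UC; split; [exact: measurableT_comp|exists C => w; exact: UC].
Qed.

Lemma L1_dist_distribution (U V : S -> R) : measurable_fun setT U ->
  measurable_fun setT V ->
  L1_dist (distribution P X) U V = L1_dist P (U \o X) (V \o X).
Proof.
move=> mU mV; rewrite /L1_dist ge0_integral_distribution//.
exact: measurable_fun_distance.
Qed.

(** The identity holds for indicators by definition, it is linear in U, and it is
    stable under L1 limits because the residual y - G(X) is bounded; so it extends
    to bounded U by density of the indicators. *)
Lemma averages_to_orthogonal (y : Omega -> R) (G U : S -> R) (C : R) :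
  bounded_mfun y -> measurable_fun setT G -> (forall x, `|G x| <= C) ->
  averages_to y G ->
  measurable_fun setT U -> (forall x, `|U x| <= C) ->
  \int[P]_w (U (X w) * (y w - G (X w))) = 0.
Proof.
move=> bdd_y mG GC avg mU UC.
have bdd_G := bounded_mfun_RV mG GC.
pose r w := y w - G (X w).
have bdd_r : bounded_mfun r by exact: bounded_mfunB.
pose V := [set v : S -> R | [/\ measurable_fun setT v, bounded_mfun (v \o X) &
  \int[P]_w (v (X w) * r w) = 0]].
have integrable_mul v : bounded_mfun (v \o X) ->
    P.-integrable setT (EFin \o (fun w => v (X w) * r w)).
  by move=> bv; apply: bounded_mfun_integrable => //; exact: bounded_mfunM bv bdd_r.
have U_closure : L1_closure (distribution P X) V U.
  apply: (@L1_closure_integrable _ _ _ _ _ _ _ _ measurable).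
  - by move=> v [].
  - move=> v w [mv bv iv] [mw bw iw]; split.
    + exact: measurable_funD.
    + exact: bounded_mfunD.
    + under eq_Rintegral do rewrite mulrDl.
      by rewrite RintegralD// ?iv ?iw ?addr0//; exact: integrable_mul.
  - move=> c v [mv bv iv]; split.
    + exact: measurable_funM.
    + exact: bounded_mfunM (bounded_mfun_cst c) bv.
    + under eq_Rintegral do rewrite -mulrA.
      by rewrite RintegralZl// ?iv ?mulr0//; exact: integrable_mul.
  - exact: measurableI.
  - exact: measurableT.
  - exact: sub_sigma_algebra.
  - move=> A mA; apply: L1_closure_id; first by move=> v [].
    have mXA := measurable_preimage_RV mA.
    split; first exact: measurable_indic.
      apply: (@bounded_mfun_RV _ 1); first exact: measurable_indic.
      by move=> x; rewrite indicE; case: (_ \in _); rewrite ?normr1 ?normr0.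
    rewrite (_ : \int[P]_w _ = \int[P]_(w in X @^-1` A) r w).
      rewrite RintegralB//; first by rewrite avg// subrr.
        exact: bounded_mfun_integrable.
      exact: bounded_mfun_integrable.
    rewrite [RHS]Rintegral_mkcond; apply: eq_Rintegral => w _.
    rewrite patchE indicE; have [Aw|nAw] := pselect (A (X w)).
      by rewrite !mem_set// mul1r.
    by rewrite !memNset// mul0r.
  - apply: measurable_bounded_integrable => //.
    + by rewrite (le_lt_trans (probability_le1 _ _))// ltry.
    + by exists C; split; [exact: num_real|move=> D CD w _; rewrite /= (le_trans (UC w))// ltW].
have [_ [D rD]] := bdd_r.
apply/eqP; rewrite -normr_le0; apply/ler_addgt0Pr => e e0; rewrite add0r.
have D0 : 0 < `|D| + 1 by rewrite ltr_wpDl.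
have [v [mv bv iv] Uv] := U_closure.2 (e / (`|D| + 1)) ltac:(by rewrite divr_gt0).
have bU := bounded_mfun_RV mU UC.
have bUv : bounded_mfun (fun w => U (X w) - v (X w)) by exact: bounded_mfunB bU bv.
have -> : \int[P]_w (U (X w) * (y w - G (X w))) =
          \int[P]_w ((U (X w) - v (X w)) * r w).
  under [RHS]eq_Rintegral do rewrite mulrBl.
  rewrite RintegralB//; [by rewrite iv subr0|exact: integrable_mul|exact: integrable_mul].
have iUv : P.-integrable setT (EFin \o (fun w => (U (X w) - v (X w)) * r w)).
  by apply: bounded_mfun_integrable => //; exact: bounded_mfunM.
apply: le_trans (le_normr_Rintegral measurableT iUv) _.
have inorm := bounded_mfun_integrable (bounded_mfun_norm bUv) measurableT.
apply: le_trans (_ : \int[P]_w ((`|D| + 1) * `|U (X w) - v (X w)|) <= _).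
  apply: le_Rintegral => //; first exact: (integrable_norm iUv).
    apply: bounded_mfun_integrable => //.
    exact: bounded_mfunM (bounded_mfun_cst _) (bounded_mfun_norm bUv).
  move=> w _; rewrite normrM mulrC ler_wpM2r// (le_trans (rD w))//.
  by rewrite (le_trans (ler_norm _))// lerDl.
rewrite RintegralZl//.
rewrite -ler_pdivlMl// mulrC -lee_fin /Rintegral fineK.
  by move: Uv; rewrite L1_dist_distribution.
exact: integrable_fin_num.
Qed.

Lemma averages_to_pythagoras (y : Omega -> R) (G H : S -> R) (C : R) :
  bounded_mfun y -> measurable_fun setT G -> (forall x, `|G x| <= C) ->
  averages_to y G -> measurable_fun setT H -> (forall x, `|H x| <= C) ->
  \int[P]_w (y w - H (X w)) ^+ 2 =
  \int[P]_w (y w - G (X w)) ^+ 2 + \int[P]_w (G (X w) - H (X w)) ^+ 2.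
Proof.
move=> bdd_y mG GC avg mH HC.
have bG := bounded_mfun_RV mG GC; have bH := bounded_mfun_RV mH HC.
have byG := bounded_mfunB bdd_y bG; have bGH := bounded_mfunB bG bH.
have iyG := bounded_mfun_integrable (bounded_mfunM byG byG) measurableT.
have iGH := bounded_mfun_integrable (bounded_mfunM bGH bGH) measurableT.
have icross := bounded_mfun_integrable (bounded_mfunM bGH byG) measurableT.
have cross0 : \int[P]_w ((G (X w) - H (X w)) * (y w - G (X w))) = 0.
  apply: (averages_to_orthogonal (U := fun x => G x - H x) (C := C + C)) => //.
  - by move=> x; rewrite (le_trans (GC x))// lerDl (le_trans _ (GC x)).
  - exact: measurable_funB.
  - by move=> x; rewrite (le_trans (ler_normB _ _))// lerD.
transitivity (\int[P]_w ((y w - G (X w)) * (y w - G (X w)) +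
    ((G (X w) - H (X w)) * (G (X w) - H (X w)) +
     2 * ((G (X w) - H (X w)) * (y w - G (X w)))))).
  by apply: eq_Rintegral => w _; ring.
have i2cross := bounded_mfun_integrable
  (bounded_mfunM (bounded_mfun_cst 2) (bounded_mfunM bGH byG)) measurableT.
rewrite RintegralD//; last exact: integrableD iGH i2cross.
rewrite RintegralD//.
by rewrite RintegralZl// cross0 mulr0 addr0.
Qed.

End conditional_expectation.

(** * Truncation, and measurability of networks *)

Section clamp.
Variable R : realType.

Definition clamp (s x : R) : R := Num.max (- s) (Num.min x s).

Lemma norm_clamp_le (s x : R) : 0 <= s -> `|clamp s x| <= s.
Proof.
move=> s0; rewrite /clamp ler_norml le_max lexx/= ge_max ge_min lexx orbT andbT.
by rewrite (le_trans _ s0)// oppr_le0.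
Qed.

Lemma clamp_id (s x : R) : `|x| <= s -> clamp s x = x.
Proof. by rewrite /clamp ler_norml => /andP[sx xs]; rewrite min_l// max_r. Qed.

Lemma clamp_lipschitz (s x y : R) : `|clamp s x - clamp s y| <= `|x - y|.
Proof.
wlog xy : x y / x <= y => [hw|].
  by have [/hw//|/ltW/hw] := leP x y; rewrite distrC (distrC x).
rewrite (distrC x) (ger0_norm (_ : 0 <= y - x)) ?subr_ge0// ler_norml /clamp.
have [?|?] := leP x s; have [?|?] := leP y s.
- by have [?|?] := leP (- s) x; have [?|?] := leP (- s) y; apply/andP; split; lra.
- by have [?|?] := leP (- s) x; have [?|?] := leP (- s) s; apply/andP; split; lra.
- by have [?|?] := leP (- s) s; have [?|?] := leP (- s) y; apply/andP; split; lra.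
- by have [?|?] := leP (- s) s; apply/andP; split; lra.
Qed.

Lemma measurable_clamp d (T : measurableType d) (s : R) (h : T -> R) :
  measurable_fun setT h -> measurable_fun setT (fun x => clamp s (h x)).
Proof. by move=> mh; apply: measurable_maxr => //; exact: measurable_minr. Qed.

End clamp.

Section network_measurability.
Variables (R : realType) (n L K : nat) (t : net_param R n L K).

Let measurable_entries (h : borelType 'M[R]_n -> 'cV[R]_n) :=
  forall i, measurable_fun setT (fun X => h X i 0).

(** All past outputs stay measurable as the fold over the layers proceeds. *)
Lemma measurable_net : measurable_entries (fun X => net t X).
Proof.
rewrite /net.
pose F (X : 'M[R]_n) hs (l : 'I_L) := layer t X hs l :: hs.
have meas_affine (hs : 'M[R]_n -> seq 'cV[R]_n) l i :
    (forall k, measurable_entries (fun X => nth 0 (hs X) k)) ->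
    measurable_entries (fun X => affine t X (hs X) l i).
  move=> mhs r; rewrite /affine; under eq_fun do rewrite mxE summxE.
  apply: measurable_funD => //; apply: measurable_sum => k.
  under eq_fun do rewrite mxE.
  apply: measurable_funD.
    under eq_fun do rewrite mxE.
    by apply: measurable_sum => c; apply: measurable_funM => //; exact: mhs.
  under eq_fun do rewrite mxE.
  apply: measurable_sum => c; apply: measurable_funM; last exact: mhs.
  under eq_fun do rewrite mxE.
  apply: measurable_sum => e; apply: measurable_funM => //.
  exact: measurable_coord.
suff fold_meas (e : seq 'I_L) (hs : 'M[R]_n -> seq 'cV[R]_n) :
    (forall k, measurable_entries (fun X => nth 0 (hs X) k)) ->
    forall k, measurable_entries (fun X => nth 0 (foldl (F X) (hs X) e) k).
  move=> i; under eq_fun do rewrite -nth0.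
  by apply: (fold_meas (enum 'I_L) (fun=> [::])) => k j; rewrite nth_nil; exact: measurable_cst.
elim: e hs => //= l e IH hs mhs.
apply: (IH (fun X => F X (hs X) l)) => -[|k] //= i; rewrite /layer.
under eq_fun do rewrite mxE [X in _ + X]mxE.
apply: measurable_funD; first exact: meas_affine.
by apply: measurable_maxr => //; exact: meas_affine.
Qed.

End network_measurability.

(** * Excess risk of the minimizers *)

Section network_approximation.
Context d d' (Omega : measurableType d) (S : measurableType d') (R : realType).
Variables (P : probability Omega R) (X : {RV P >-> S}).
Variables (n K : nat) (K_gt2 : (2 < K)%N).
Variable N : S -> borelType 'M[R]_n.
Hypothesis N_meas : measurable_fun setT N.
Hypothesis N_gen : @measurable _ S `<=` g_sigma_algebra_preimage N.
Variables (s : R) (s_ge0 : 0 <= s) (G : 'I_n -> S -> R).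
Hypothesis G_meas : forall i, measurable_fun setT (G i).
Hypothesis G_le : forall i x, `|G i x| <= s.

Definition clamped_net L (t : net_param R n L K) (i : 'I_n) (x : S) : R :=
  clamp s (net t (N x) i 0).

Definition excess L (t : net_param R n L K) : R :=
  \sum_(i < n) \int[P]_w (G i (X w) - clamped_net t i (X w)) ^+ 2.

Lemma measurable_clamped_net L (t : net_param R n L K) i :
  measurable_fun setT (clamped_net t i).
Proof.
apply: measurable_clamp.
apply: (measurableT_comp (f := fun A : borelType 'M[R]_n => net t A i 0)) => //.
exact: measurable_net.
Qed.

Lemma clamped_net_le L (t : net_param R n L K) i x : `|clamped_net t i x| <= s.
Proof. exact: norm_clamp_le. Qed.

(** On functions bounded by s one has |G - T q|^2 <= 2 s |G - T q|, and the right
    side is at most 2 s |G - q| since the truncation T is 1-Lipschitz and fixes G.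
    Closeness in L1 before truncation is thus enough. *)
Lemma excess_small (e : R) : 0 < e -> exists L0, forall L, (L0 <= L)%N ->
  exists2 t : net_param R n L K, param_set t & excess t <= e.
Proof.
move=> e0.
(* 2 s + 1, and not 2 s, so that c can be divided by even if s = 0. *)
pose c := (2 * s + 1) * n.+1%:R.
have c0 : 0 < c by rewrite mulr_gt0// ltr_wpDl// mulr_ge0.
have approx i : exists q, net_scalar K q /\
    (L1_dist (distribution P X) (G i) (q \o N) <= (e / c)%:E)%E.
  have iG : (distribution P X).-integrable setT (EFin \o G i).
    apply: measurable_bounded_integrable => //.
      by rewrite (le_lt_trans (probability_le1 _ _))// ltry.
    by exists s; split; [exact: num_real|move=> D sD w _; rewrite /= (le_trans (G_le i w))// ltW].
  have [_ clG] := net_scalar_L1_dense K_gt2 N_meas N_gen iG.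
  by have [_ [q Qq <-] qG] := clG (e / c) ltac:(by rewrite divr_gt0); exists q.
have [q qP] := choice approx.
have q_real : realizable K (fun A => \sum_(i < n) (1 * q i A) *: unit_vec R n i).
  by apply: realizable_sum => i; have [[_ rq] _] := qP i; exact: rq.
have [L0 L0P] := realizable_net K_gt2 q_real.
exists L0 => L /L0P[t okt tq]; exists t => //.
have net_q A i : net t A i 0 = q i A.
  rewrite tq summxE (bigD1 i)//= big1 => [|j ji].
    by rewrite !mxE eqxx mul1r mulr1 addr0.
  by rewrite !mxE eq_sym val_eqE (negbTE ji) mulr0.
have sq_le i : \int[P]_w (G i (X w) - clamped_net t i (X w)) ^+ 2 <= e / n.+1%:R.
  have [[mq _]] := qP i.
  rewrite L1_dist_distribution//; last exact: measurableT_comp.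
  move=> close.
  have bG := bounded_mfun_RV X (G_meas i) (G_le i).
  have bH := bounded_mfun_RV X (measurable_clamped_net t i) (clamped_net_le t i).
  have bGH := bounded_mfunB bG bH.
  have iGH := bounded_mfun_integrable P (bounded_mfunM bGH bGH) measurableT.
  rewrite -lee_fin /Rintegral fineK; last exact: integrable_fin_num.
  apply: le_trans (_ : ((2 * s + 1)%:E * L1_dist P (G i \o X) (q i \o N \o X) <= _)%E).
    have mdist := measurable_fun_distance (measurableT_comp (G_meas i) (measurable_funP X))
      (measurableT_comp mq (measurableT_comp N_meas (measurable_funP X))).
    rewrite /L1_dist -ge0_integralZl_EFin//; last by rewrite addr_ge0// mulr_ge0.
    apply: ge0_le_integral => //.
    - by move=> w _; rewrite lee_fin sqr_ge0.
    - by case/integrableP: iGH.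
    - by apply: measurable_funeM.
    - move=> w _; rewrite -EFinM lee_fin -real_normK ?num_real// expr2.
      apply: ler_pM => //.
        rewrite (le_trans (ler_normB _ _))//.
        rewrite (le_trans (lerD (G_le _ _) (clamped_net_le _ _ _)))//.
        lra.
      rewrite /clamped_net net_q -[X in `|X - _|](clamp_id (G_le i (X w))).
      exact: clamp_lipschitz.
  apply: le_trans (lee_wpmul2l _ close) _; first by rewrite lee_fin addr_ge0// mulr_ge0.
  rewrite -EFinM lee_fin /c invfM mulrCA (mulrA (2 * s + 1)) divff ?mul1r//.
  by rewrite gt_eqF// ltr_wpDl// mulr_ge0.
apply: le_trans (_ : \sum_(i < n) (e / n.+1%:R) <= _).
  by apply: ler_sum => i _; exact: sq_le.
rewrite sumr_const card_ord -(mulr_natr (e / n.+1%:R)) -mulrA ger_pMr//.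
by rewrite mulrC ler_pdivrMr// mul1r ler_nat.
Qed.

Variable y : 'I_n -> Omega -> R.
Hypothesis y_bounded : forall i, bounded_mfun (y i).
Hypothesis y_G : forall i, averages_to X (y i) (G i).

Definition squared_error L (t : net_param R n L K) : R :=
  \sum_(i < n) \int[P]_w (y i w - clamped_net t i (X w)) ^+ 2.

Lemma excess_pythagoras L (t : net_param R n L K) :
  squared_error t = \sum_(i < n) \int[P]_w (y i w - G i (X w)) ^+ 2 + excess t.
Proof.
rewrite -big_split; apply: eq_bigr => i _ /=.
apply: (averages_to_pythagoras (C := s)) => //.
- exact: measurable_clamped_net.
- exact: clamped_net_le.
Qed.

(** The squared error and the excess differ by a constant, so a minimizer of the
    first is at least as good for the second as the networks of small excess. *)
Theorem cvg_excess_minimizer (theta : forall L, net_param R n L K) :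
  (forall L (t : net_param R n L K), (0 < L)%N -> param_set t ->
     squared_error (theta L) <= squared_error t) ->
  excess (theta L) @[L --> \oo] --> (0 : R).
Proof.
move=> theta_min; apply/cvgrPdist_le => e e0.
have [L0 L0P] := excess_small e0.
exists (maxn L0 1) => // L /=; rewrite geq_max => /andP[L0L L_gt0].
have [t okt t_small] := L0P L L0L.
have excess_ge0 : 0 <= excess (theta L).
  by apply: sumr_ge0 => i _; apply: Rintegral_ge0 => w _; exact: sqr_ge0.
rewrite sub0r normrN (ger0_norm excess_ge0); apply: (le_trans _ t_small).
have := theta_min L t L_gt0 okt.
by rewrite !excess_pythagoras lerD2l.
Qed.

End network_approximation.

(** * Euclidean norm, and the risk as an integral over the sample space *)

Section euclidean_norm.
Variables (R : realType) (n : nat).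

Lemma norm2_ge0 (v : 'cV[R]_n) : 0 <= norm2 v.
Proof. exact: sqrtr_ge0. Qed.

Lemma sqr_norm2 (v : 'cV[R]_n) : norm2 v ^+ 2 = \sum_(i < n) v i 0 ^+ 2.
Proof. by rewrite sqr_sqrtr// sumr_ge0// => i _; exact: sqr_ge0. Qed.

Lemma coord_le_norm2 (v : 'cV[R]_n) i : `|v i 0| <= norm2 v.
Proof.
rewrite -(@ler_pXn2r _ 2)// ?nnegrE ?norm2_ge0//.
rewrite real_normK ?num_real// sqr_norm2 (bigD1 i)//= lerDl sumr_ge0// => j _.
exact: sqr_ge0.
Qed.

Lemma supnorm_ge0 (f : 'M[R]_n -> 'cV[R]_n) :
  (exists C : R, forall A, opball 1 A -> norm2 (f A) <= C) -> 0 <= supnorm f.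
Proof.
move=> [C fC]; rewrite /supnorm.
have [[A BA]|empty] := pselect (exists A : 'M[R]_n, opball 1 A); last first.
  rewrite (_ : [set _ | _ in _] = set0) ?sup0//.
  by apply/seteqP; split=> // r [A BA _]; apply: empty; exists A.
apply: le_trans (norm2_ge0 (f A)) _; apply: ub_le_sup; last by exists A.
by exists C => _ [B BB <-]; exact: fC.
Qed.

Lemma norm2_le_supnorm (f : 'M[R]_n -> 'cV[R]_n) A :
  (exists C : R, forall A, opball 1 A -> norm2 (f A) <= C) ->
  opball 1 A -> norm2 (f A) <= supnorm f.
Proof.
move=> [C fC] BA; apply: ub_le_sup; last by exists A.
by exists C => _ [B BB <-]; exact: fC.
Qed.

End euclidean_norm.

(** The preimage of an open set differs from a measurable set only inside the null
    set where X is not in A, and by completeness that part is measurable. *)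
Lemma measurable_fun_ae_within_continuous d (Omega : measurableType d)
    (R : realType) (P : probability Omega R) (T U : ptopologicalType)
    (X : Omega -> borelType T) (f : T -> U) (A : set T) :
  measure_is_complete P -> measurable_fun setT X -> {ae P, forall w, A (X w)} ->
  {within A, continuous f} -> measurable_fun setT (f \o X : Omega -> borelType U).
Proof.
move=> cP mX XA cf.
apply: (@measurability _ _ Omega (borelType U) setT _ open erefl).
move=> _ [B oB <-]; rewrite setTI.
pose N := ~` [set w | A (X w)].
have mN : measurable N by exact: cP.
have /continuousP/(_ _ oB)/open_subspaceP[V oV VA] := cf.
rewrite (_ : _ @^-1` B = (X @^-1` V `\` N) `|` ((f \o X) @^-1` B `&` N)).
  apply: measurableU.
    apply: measurableD => //; rewrite -[X in measurable X]setTI; apply: mX => //.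
    exact: sub_sigma_algebra.
  by apply: cP; apply: negligibleS XA; exact: subIsetr.
have VB w : A (X w) -> V (X w) <-> B (f (X w)).
  move=> AX; have := congr1 (fun C => C (X w)) VA; rewrite /setI/mkset/= => e.
  by split=> h; [have [] : B (f (X w)) /\ A (X w) by rewrite -e|
                 have [] : V (X w) /\ A (X w) by rewrite e].
apply/seteqP; split=> w /=.
  have [AX|nAX] := pselect (A (X w)); last by right.
  by move=> /(VB _ AX); left; split=> // nAX; exact: nAX.
by move=> [[VX /contrapT AX]|[]//]; exact/VB.
Qed.

Lemma Lfun_ae_bounded d (Omega : measurableType d) (R : realType)
    (P : probability Omega R) (h : Omega -> R) (C : R) :
  measurable_fun setT h -> {ae P, forall w, `|h w| <= C} -> h \in Lfun P 2%:E.
Proof.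
move=> mh hC; rewrite inE; apply/andP; split; rewrite inE//=.
rewrite /finite_norm unlock; apply: poweR_lty.
apply: (@le_lt_trans _ _ (\int[P]_x (C ^+ 2)%:E)%E); last first.
  rewrite integral_cst//; apply: lte_mul_pinfty; rewrite ?lee_fin ?sqr_ge0//.
  by rewrite (le_lt_trans (probability_le1 P _))// ltry.
apply: ae_ge0_le_integral => //.
- by move=> w _; exact: poweR_ge0.
- apply: (measurableT_comp (measurable_poweR _)) => //.
  by apply: measurableT_comp => //; exact/measurable_EFinP.
- by move=> w _; rewrite lee_fin sqr_ge0.
- apply: filterS hC => w hwC _; change (`|h w|%:E `^ 2 <= (C ^+ 2)%:E)%E.
  rewrite poweR_EFin powR_mulrn// lee_fin.
  by rewrite ler_pXn2r// nnegrE (le_trans _ hwC).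
Qed.

(** The integrand v is only almost everywhere equal to bounded functions h, but the
    latter give a finite, real-valued expression for its squared L2 norm. *)
Lemma integral_sqr_norm2 d (Omega : measurableType d) (R : realType)
    (P : probability Omega R) (n : nat) (v : Omega -> 'cV[R]_n)
    (h : 'I_n -> Omega -> R) :
  (forall i, measurable_fun setT (fun w => v w i 0)) ->
  (forall i, bounded_mfun (h i)) -> {ae P, forall w, forall i, v w i 0 = h i w} ->
  (\int[P]_w (norm2 (v w) ^+ 2)%:E)%E = (\sum_(i < n) \int[P]_w (h i w ^+ 2))%:E.
Proof.
move=> mv bh vh.
transitivity (\int[P]_w (\sum_(i <- index_enum 'I_n) (v w i 0 ^+ 2)%:E)%E)%E.
  by apply: eq_integral => w _; rewrite sqr_norm2 sumEFin.
have msq (u : Omega -> R) : measurable_fun setT u ->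
    measurable_fun setT (fun w => (u w ^+ 2)%:E : \bar R).
  by move=> mu; apply/measurable_EFinP; exact: measurable_funX.
rewrite ge0_integral_sum//; last 2 first.
  by move=> i; exact: msq.
  by move=> i w _; rewrite lee_fin sqr_ge0.
rewrite -sumEFin; apply: eq_bigr => i _.
rewrite /Rintegral fineK; last first.
  exact: integrable_fin_num (bounded_mfun_integrable P (bounded_mfunM (bh i) (bh i)) _).
apply: ae_eq_integral => //; [exact: msq|exact/msq/(bh i).1|].
by apply: filterS vh => w vh _; rewrite vh.
Qed.

Lemma trunc_netE (R : realType) (n L K : nat) (t : net_param R n L K)
    (f : 'M[R]_n -> 'cV[R]_n) (A : 'M[R]_n) i :
  trunc_net t f A i 0 = clamp (supnorm f) (net t A i 0).
Proof. by rewrite mxE. Qed.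

Lemma risk_pushforward d (Omega : measurableType d) (R : realType)
    (P : probability Omega R) (n L K : nat) (f : 'M[R]_n -> 'cV[R]_n)
    (M : Omega -> borelType 'M[R]_n) (y : Omega -> borelType 'cV[R]_n)
    (t : net_param R n L K) :
  measurable_fun setT M -> measurable_fun setT y ->
  risk (pushforward P (fun w => (M w, y w))) f t =
  (\int[P]_w ((norm2 ((y w : 'cV[R]_n) - trunc_net t f (M w))) ^+ 2)%:E)%E.
Proof.
move=> mM my; rewrite /risk ge0_integral_pushforward//.
- exact: measurable_fun_pair.
- apply/measurable_EFinP; under eq_fun do rewrite sqr_norm2.
  apply: measurable_sum => i; apply: measurable_funX.
  under eq_fun do rewrite 2!mxE.
  apply: measurable_funB.
    exact: (measurableT_comp (measurable_coord i 0) measurable_snd).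
  under eq_fun do rewrite trunc_netE; apply: measurable_clamp.
  exact: (measurableT_comp (measurable_net t i) measurable_fst).
- by move=> p _; rewrite lee_fin sqr_ge0.
Qed.

Lemma Lnorm2_norm2 d (Omega : measurableType d) (R : realType)
    (P : probability Omega R) (n : nat) (v : Omega -> 'cV[R]_n) (a : R) :
  0 <= a -> (\int[P]_w (norm2 (v w) ^+ 2)%:E)%E = a%:E ->
  Lnorm P 2%:E (fun w => (norm2 (v w))%:E) = (Num.sqrt a)%:E.
Proof.
move=> a0 va; rewrite unlock -powR12_sqrt// -poweR_EFin -va; congr (_ `^ _)%E.
apply: eq_integral => w _.
change (`|norm2 (v w)|%:E `^ 2 = (norm2 (v w) ^+ 2)%:E)%E.
by rewrite poweR_EFin powR_mulrn// ger0_norm// norm2_ge0.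
Qed.

(** * Convergence of the optimal networks *)

Unset Implicit Arguments.

Theorem proposition4p4
  (R : realType) (d : measure_display) (Omega : measurableType d)
  (P : probability Omega R) (hP : measure_is_complete P)
  (n : nat) (hn : (0 < n)%N)
  (f : 'M[R]_n -> 'cV[R]_n)
  (f_bounded : exists C : R, forall X, opball 1 X -> norm2 (f X) <= C)
  (f_continuous : {within opball 1, continuous f})
  (m : nat) (z : {RV P >-> borelType 'cV[R]_m})
  (F : 'cV[R]_m -> 'M[R]_n)
  (X : {RV P >-> borelType 'M[R]_n}) (hX : forall w, X w = F (z w))
  (X_ball : {ae P, forall w, opball 2^-1 (X w)})
  (E : {RV P >-> borelType 'M[R]_n})
  (E_indep : independent_RVs P X E)
  (E_ball : {ae P, forall w, opball 2^-1 (E w)})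
  (y : Omega -> borelType 'cV[R]_n) (hy : forall w, y w = f (X w))
  (M : Omega -> borelType 'M[R]_n)
  (hM : forall w, M w = (X w : 'M[R]_n) + (E w : 'M[R]_n))
  (tau : set (borelType 'M[R]_n * borelType 'cV[R]_n) -> \bar R)
  (htau : tau = pushforward P (fun w => (M w, y w)))
  (theta : forall L : nat, net_param R n L (2 * n + 1))
  (theta_min : forall L : nat, (0 < L)%N -> is_minimizer tau f (theta L))
  (g : Omega -> 'cV[R]_n) (hg : is_cond_exp P M y g) :
  cvg_L2 P (fun L w => trunc_net (theta L) f (M w)) g.
Proof.
set s := supnorm f.
have s_ge0 : 0 <= s by exact: supnorm_ge0.
have K_gt2 : (2 < 2 * n + 1)%N by rewrite mul2n addn1 ltnS -(leq_double 1) in hn *.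
have M_meas : measurable_fun setT M.
  apply: measurable_fun_mx => i j; under eq_fun do rewrite hM mxE.
  by apply: measurable_funD; apply: (measurableT_comp (measurable_coord i j)).
have y_meas : measurable_fun setT y.
  rewrite (_ : y = f \o X); last by apply/funext => w; rewrite hy.
  apply: (measurable_fun_ae_within_continuous (A := opball 1) hP) => //.
  by apply: filterS X_ball => w /le_trans; apply; rewrite invf_le1// ler1n.
have yi_meas i : measurable_fun setT (fun w => y w i 0).
  exact: (measurableT_comp (measurable_coord i 0)).
have y_le : {ae P, forall w, forall i, `|y w i 0| <= s}.
  apply: filterS X_ball => w Xw i; rewrite hy (le_trans (coord_le_norm2 _ _))//.
  by apply: norm2_le_supnorm => //; apply: le_trans Xw _; rewrite invf_le1// ler1n.
(* The identity, seen as a random variable with values in Omega equipped with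
   the sigma-algebra of M. *)
pose S := g_sigma_algebra_preimageType M.
have id_meas : measurable_fun [set: Omega] (id : Omega -> S).
  by move=> _ _ [B mB <-]; rewrite setTI setTI -[X in measurable X]setTI; exact: M_meas.
pose I : {RV P >-> S} := mfun_Sub (mem_set id_meas).
have M_measS : measurable_fun [set: S] (M : S -> borelType 'M[R]_n).
  by move=> _ B mB; exists B.
(* Versions of y and g that are bounded everywhere, and not only almost surely. *)
pose y' i w := clamp s (y w i 0).
pose g' i (x : S) := clamp s (g x i 0).
have y'_bounded i : bounded_mfun (y' i).
  by split; [exact: measurable_clamp|exists s => w; exact: norm_clamp_le].
have y'E i : {ae P, forall w, y' i w = y w i 0}.
  by apply: filterS y_le => w yw; exact: clamp_id.
have g_measS i : measurable_fun [set: S] (fun x : S => g x i 0) by have [] := hg i.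
have g_meas i : measurable_fun [set: Omega] (fun w => g w i 0).
  exact: (measurableT_comp (g_measS i) id_meas).
have g'_measS i : measurable_fun setT (g' i) by exact: measurable_clamp.
have y'_g i : averages_to I (y' i) (fun x => g x i 0).
  move=> A mA; have [_ _ gy] := hg i; rewrite /Rintegral gy//; congr fine.
  have mA' := measurable_preimage_RV I mA.
  apply: ae_eq_integral => //.
  - by apply/measurable_EFinP; exact: measurable_funTS.
  - by apply/measurable_EFinP; apply: measurable_funTS; exact: (y'_bounded i).1.
  - by apply: filterS (y'E i) => w -> _.
have g_le : {ae P, forall w, forall i, `|g w i 0| <= s}.
  apply: filter_forall => i; have [_ ig _] := hg i.
  have upper := averages_to_le (X := I) (b := 1) (C := s) (y'_bounded i) (g_measS i) ig (y'_g i).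
  have lower := averages_to_le (X := I) (b := -1) (C := s) (y'_bounded i) (g_measS i) ig (y'_g i).
  have y's w : `|y' i w| <= s by exact: norm_clamp_le.
  apply: filterS2 (upper _) (lower _) => [w|w|w].
  - rewrite mul1r mulN1r => gs Ngs; rewrite ler_norml gs andbT.
    by rewrite lerNl.
  - by rewrite mul1r (le_trans (ler_norm _)).
  - by rewrite mulN1r (le_trans (ler_norm _))// normrN.
have g'E : {ae P, forall w : Omega, forall i, g' i w = g w i 0}.
  by apply: filterS g_le => w gw i; exact: clamp_id.
have y'_g' i : averages_to I (y' i) (g' i).
  move=> A mA; rewrite -y'_g// /Rintegral; congr fine.
  have mA' := measurable_preimage_RV I mA.
  apply: ae_eq_integral => //.
  - apply/measurable_EFinP; apply: measurable_funTS.
    exact: (measurableT_comp (g'_measS i) id_meas).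
  - by apply/measurable_EFinP; exact: measurable_funTS.
  - have g'Ei : {ae P, forall w : Omega, g' i w = g w i 0} by apply: filterS g'E => w; exact.
    by apply: filterS g'Ei => w /= -> _.
have net_bounded L (t : net_param R n L (2 * n + 1)) i :
    bounded_mfun (clamped_net M s t i).
  exact: (bounded_mfun_RV I (measurable_clamped_net M_measS s t i)
    (clamped_net_le M s_ge0 t i)).
have net_meas L (t : net_param R n L (2 * n + 1)) i :
    measurable_fun [set: Omega] (clamped_net M s t i) := (net_bounded L t i).1.
have risk_eq L (t : net_param R n L (2 * n + 1)) :
    risk tau f t = (squared_error I M s y' t)%:E.
  rewrite htau risk_pushforward//.
  apply: (integral_sqr_norm2 (h := fun i w => y' i w - clamped_net M s t i w)).
  - move=> i; under eq_fun do rewrite 2!mxE trunc_netE.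
    by apply: measurable_funB => //; exact: net_meas.
  - by move=> i; apply: bounded_mfunB => //; exact: net_bounded.
  - apply: filterS y_le => w yw i; rewrite 2!mxE trunc_netE.
    by rewrite /y' (clamp_id (yw i)).
have min L (t : net_param R n L (2 * n + 1)) : (0 < L)%N -> param_set t ->
    squared_error I M s y' (theta L) <= squared_error I M s y' t.
  move=> L_gt0 okt; have [_ /(_ t okt)] := theta_min L L_gt0.
  by rewrite !risk_eq lee_fin.
have excess_cvg := cvg_excess_minimizer K_gt2 M_measS (fun _ mA => mA) s_ge0
  g'_measS (fun i x => norm_clamp_le (g x i 0) s_ge0) y'_bounded y'_g' min.
have trunc_eq k i : (fun w => trunc_net (theta k) f (M w) i 0) =
    clamped_net M s (theta k) i by apply/funext => w; exact: trunc_netE.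
have Lnorm_eq k : Lnorm P 2%:E
    (fun w => (norm2 (trunc_net (theta k) f (M w) - g w))%:E) =
    (Num.sqrt (excess I M s g' (theta k)))%:E.
  apply: Lnorm2_norm2.
    by apply: sumr_ge0 => i _; apply: Rintegral_ge0 => w _; exact: sqr_ge0.
  rewrite (integral_sqr_norm2 (h := fun i w => clamped_net M s (theta k) i w - g' i w)).
  - congr EFin; apply: eq_bigr => i _; apply: eq_Rintegral => w _.
    by rewrite -sqrrN opprB.
  - move=> i; under eq_fun do rewrite mxE trunc_netE mxE.
    by apply: measurable_funB => //; exact: net_meas.
  - move=> i; apply: bounded_mfunB => //.
    exact: (bounded_mfun_RV I (g'_measS i) (fun x => norm_clamp_le (g x i 0) s_ge0)).
  - by apply: filterS g'E => w gw i; rewrite mxE trunc_netE mxE gw.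
split=> [k i|i|].
- rewrite trunc_eq; apply: (Lfun_ae_bounded (C := s)); first exact: net_meas.
  by apply: aeW => w; exact: clamped_net_le.
- by apply: (Lfun_ae_bounded (C := s)) => //; apply: filterS g_le => w gw.
- under eq_fun do rewrite Lnorm_eq.
  apply: cvg_EFin; first exact: nearW.
  rewrite -[X in _ --> X]sqrtr0.
  apply: (cvg_comp _ _ excess_cvg); exact: sqrt_continuous.
Qed.
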